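(* Let $\alpha\in(0,1]$, $\gamma\in(0,\infty)$, $s\in\mathbb{R}$, and $\Gamma(x,t)=x-t^\alpha$ for $t\in[0,1]$. Suppose there is a constant $C$ such that for all Schwartz functions $f$ on $\mathbb{R}$, $$\Big\|\sup_{t\in[0,1]}|P_\gamma f(\Gamma(x,t),t)|\Big\|_{L^2([-1,1])}\le C\|f\|_{H^s}.$$ Then $s\ge\max\{\tfrac12-\tfrac\alpha\gamma,0\}$ if $\gamma\in(0,1)$, and $s\ge\max\{\tfrac12-\alpha,0\}$ if $\gamma\in[1,\infty)$.
   Context: For $\gamma>0$ and $t\in[0,1]$, $$P_\gamma f(\Gamma(x,t),t)=\frac1{2\pi}\int_{\mathbb{R}}e^{i(\Gamma(x,t)\xi+t|\xi|^2)}e^{-t^\gamma|\xi|^2}\hat f(\xi)\,d\xi,$$ where $\hat f(\xi)=\int e^{-ix\xi}f(x)\,dx$, and $\|f\|_{H^s}=\|(1+|\xi|^2)^{s/2}\hat f\|_{L^2}$. *)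

(* Defs.v *)
(* over an arbitrary R : realType.
   Complex numbers are represented as pairs (real part, imaginary part). *)
From HB Require Import structures.
From mathcomp Require Import all_boot all_order all_algebra.
From mathcomp Require Import all_classical all_reals all_analysis.
Set Implicit Arguments. Unset Strict Implicit. Unset Printing Implicit Defensive.
Import Order.TTheory GRing.Theory Num.Theory.
Local Open Scope classical_set_scope.
Local Open Scope ring_scope.

Section Defs.
Context {R : realType}.

Notation mu := (@lebesgue_measure R).

Definition schwartzR (g : R -> R) : Prop :=
  (forall (n : nat) (x : R), derivable (derive1n n g) x 1) /\
  (forall k n : nat, exists M : R, forall x : R,
      `|x| ^+ k * `|derive1n n g x| <= M).

Definition schwartz (f : R -> R * R) : Prop :=
  schwartzR (fun x => (f x).1) /\ schwartzR (fun x => (f x).2).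

(* Fourier transform  \hat f(xi) = \int e^{-i x xi} f(x) dx, as (Re, Im). *)
Definition fourier (f : R -> R * R) (xi : R) : R * R :=
  (Rintegral mu setT (fun x => cos (x * xi) * (f x).1 + sin (x * xi) * (f x).2),
   Rintegral mu setT (fun x => cos (x * xi) * (f x).2 - sin (x * xi) * (f x).1)).

(* P_gamma f (y, t) = (2 pi)^{-1} \int e^{i (y xi + t xi^2)} e^{- t^gamma xi^2} \hat f(xi) dxi,
   as (Re, Im); the point y will be Gamma(x,t). *)
Definition Pgamma (gamma : R) (f : R -> R * R) (y t : R) : R * R :=
  let ph xi := y * xi + t * xi ^+ 2 in
  let w xi := expR (- (powR t gamma * xi ^+ 2)) in
  ((2 * pi)^-1 * Rintegral mu setT (fun xi =>
        w xi * (cos (ph xi) * (fourier f xi).1 - sin (ph xi) * (fourier f xi).2)),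
   (2 * pi)^-1 * Rintegral mu setT (fun xi =>
        w xi * (sin (ph xi) * (fourier f xi).1 + cos (ph xi) * (fourier f xi).2))).

Definition cnorm (z : R * R) : R := Num.sqrt (z.1 ^+ 2 + z.2 ^+ 2).

Definition Hs_norm (s : R) (f : R -> R * R) : \bar R :=
  poweR (\int[mu]_(xi in setT)
           ((powR (1 + xi ^+ 2) (s / 2) * cnorm (fourier f xi)) ^+ 2)%:E) (2^-1).

Definition maximal_norm (gamma : R) (Gam : R -> R -> R) (f : R -> R * R) : \bar R :=
  let S x := ereal_sup [set (cnorm (Pgamma gamma f (Gam x t) t))%:E
                         | t in `[0, 1]%classic] in
  poweR (\int[mu]_(x in `[-1, 1]%classic) (S x * S x)%E) (2^-1).

End Defs.

(* Main.v *)
(* The inequality is tested on the Gaussians [f(x) = exp (- b x^2 / 2)], whose frequencies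
   fill [|xi| <= N] with [N = sqrt b]. As long as [t <= 1], [|Gamma(x, t)| << 1 / N] and both
   [t N^2] and [t^gamma N^2] are small, the multiplier is close to [1] on these frequencies
   and [|P f| >= 1 / 2].
   With [t = 0] this holds for [|x| << 1 / N], and comparing with the [H^s] norm as [N]
   grows rules out [s < 0].
   Put [g = min (gamma, 1)]. With [t = x^(1 / alpha)], so that [Gamma(x, t) = 0], the bound
   holds for [0 <= x <= c N^(- 2 alpha / g)], since then [t^gamma, t <= t^g << N^(- 2)]; hence
   [N^(- 2 alpha / g) <= C' N^(2 s - 1)] for all large [N], that is [s >= 1/2 - alpha / g]. *)
Require Import Defs.
From HB Require Import structures.
From mathcomp Require Import all_boot all_order all_algebra.
From mathcomp Require Import all_classical all_reals all_analysis measurable_realfun.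
From mathcomp Require Import ring lra.
Import Order.TTheory GRing.Theory Num.Theory.
Import numFieldNormedType.Exports.
Local Open Scope classical_set_scope.
Local Open Scope ring_scope.

(** * Gaussians: integrals, decay and membership in the Schwartz class *)

Section Gaussian.
Context {R : realType}.
Notation mu := (@lebesgue_measure R).
Implicit Types (a x xi y : R) (f : R -> R).

Definition gaussian a x : R := expR (- (a * x ^+ 2)).

Lemma gaussian_gt0 a x : 0 < gaussian a x.
Proof. exact: expR_gt0. Qed.

Lemma gaussian_ge0 a x : 0 <= gaussian a x.
Proof. exact: expR_ge0. Qed.

Lemma gaussianD a b x : gaussian (a + b) x = gaussian a x * gaussian b x.
Proof. by rewrite /gaussian mulrDl opprD expRD. Qed.

Lemma gaussian_sqr a x : gaussian a x ^+ 2 = gaussian (2 * a) x.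
Proof. by rewrite mulr_natl mulr2n gaussianD. Qed.

Lemma is_derive_gaussian a x :
  is_derive x 1 (gaussian a) (- (2 * a * x) * gaussian a x).
Proof.
rewrite /gaussian; apply: is_derive_eq; rewrite /GRing.scale/=.
ring.
Qed.

Lemma continuous_gaussian a : continuous (gaussian a).
Proof.
move=> x; apply/differentiable_continuous/derivable1_diffP.
by have [] := is_derive_gaussian a x.
Qed.

Lemma normal_fun_gaussian a : 0 < a ->
  normal_fun 0 (Num.sqrt (2 * a)^-1) = gaussian a.
Proof.
move=> a0; apply/funext => x; rewrite /normal_fun /gaussian subr0.
rewrite sqr_sqrtr ?invr_ge0; last lra.
by congr expR; rewrite -mulr_natr; field; rewrite gt_eqF.
Qed.

(** Matching with the centred normal density of variance [1 / (2 a)] transfers its integrability and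
    total mass to [gaussian a]. *)
Lemma gaussian_pdf a x : 0 < a ->
  gaussian a x = Num.sqrt (pi / a) * normal_pdf 0 (Num.sqrt (2 * a)^-1) x.
Proof.
move=> a0; have s0 : Num.sqrt (2 * a)^-1 != 0.
  by rewrite gt_eqF// sqrtr_gt0 invr_gt0; lra.
rewrite normal_pdfE//= normal_fun_gaussian// /normal_peak sqr_sqrtr; last first.
  by rewrite invr_ge0; lra.
rewrite (_ : _ *+ 2 = pi / a); last by rewrite -mulr_natr; field; rewrite gt_eqF.
by rewrite mulrA divff ?mul1r// gt_eqF// sqrtr_gt0 divr_gt0 ?pi_gt0.
Qed.

Lemma integrable_gaussian a : 0 < a -> mu.-integrable setT (EFin \o gaussian a).
Proof.
move=> a0.
rewrite (_ : _ \o _ = (fun x => (Num.sqrt (pi / a))%:E *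
   (normal_pdf 0 (Num.sqrt (2 * a)^-1) x)%:E)%E); last first.
  by apply/funext => x/=; rewrite gaussian_pdf// EFinM.
by apply: integrableZl => //; exact: integrable_normal_pdf.
Qed.

Lemma integral_gaussian a : 0 < a ->
  (\int[mu]_x (gaussian a x)%:E = (Num.sqrt (pi / a))%:E)%E.
Proof.
move=> a0; under eq_integral do rewrite gaussian_pdf// EFinM.
rewrite integralZl//; last exact: integrable_normal_pdf.
by rewrite integral_normal_pdf mule1.
Qed.

Lemma Rintegral_gaussian a : 0 < a ->
  Rintegral mu setT (gaussian a) = Num.sqrt (pi / a).
Proof. by move=> a0; rewrite /Rintegral integral_gaussian. Qed.

Lemma integrable_le_gaussian a K f : 0 < a -> measurable_fun setT f ->
  (forall x, `|f x| <= K * gaussian a x) -> mu.-integrable setT (EFin \o f).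
Proof.
move=> a0 mf fK.
apply: (@le_integrable _ _ _ mu setT measurableT _ (fun x => K%:E * (gaussian a x)%:E)%E) => //.
- exact/measurable_EFinP.
- move=> x _ /=; rewrite lee_fin; apply: le_trans (fK x) _.
  exact: ler_norm.
- by apply: integrableZl => //; exact: integrable_gaussian.
Qed.

(** By [1 + a x^2 <= exp (a x^2)] this reduces to a polynomial inequality, which follows from
    [2 |x| <= 1 + x^2]. *)
Lemma norm_gaussian_le a x : 0 < a -> `|x| * gaussian a x <= 1 + a^-1.
Proof.
move=> a0; rewrite /gaussian expRN ler_pdivrMr ?expR_gt0//.
have h : 1 + a * x ^+ 2 <= expR (a * x ^+ 2) by exact: expR_ge1Dx.
apply: (@le_trans _ _ ((1 + a^-1) * (1 + a * x ^+ 2))); last first.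
  by apply: ler_wpM2l => //; rewrite addr_ge0// invr_ge0 ltW.
have -> : (1 + a^-1) * (1 + a * x ^+ 2) = 1 + x ^+ 2 + a^-1 + a * x ^+ 2.
  by field; rewrite gt_eqF.
have ai : 0 < a^-1 by rewrite invr_gt0.
have ax : 0 <= a * x ^+ 2 by rewrite mulr_ge0 ?sqr_ge0// ltW.
have : 0 <= (`|x| - 1) ^+ 2 by exact: sqr_ge0.
by rewrite -(real_normK (num_real x)); have := normr_ge0 x; nra.
Qed.

(** Half of the exponent absorbs [|x|] and the other half stays integrable. This yields the
    dominating function for differentiation under the integral. *)
Lemma norm_gaussian_le_half a x : 0 < a ->
  `|x| * gaussian a x <= (1 + (a / 2)^-1) * gaussian (a / 2) x.
Proof.
move=> a0; rewrite [in leLHS](splitr a) gaussianD mulrA ler_wpM2r ?gaussian_ge0//.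
by apply: norm_gaussian_le; lra.
Qed.

Lemma horner_gaussian_bounded (p : {poly R}) a : 0 < a ->
  exists M, forall x, `|p.[x]| * gaussian a x <= M.
Proof.
elim/poly_ind: p a => [|p c IH] a a0.
  by exists 0 => x; rewrite horner0 normr0 mul0r.
have a20 : 0 < a / 2 by lra.
have [M pM] := IH _ a20; exists (M * (1 + (a / 2)^-1) + `|c|) => x.
rewrite hornerMXaddC; apply: (@le_trans _ _ ((`|p.[x] * x| + `|c|) * gaussian a x)).
  by rewrite ler_wpM2r ?gaussian_ge0// ler_normD.
rewrite mulrDl lerD//; last first.
  by rewrite ler_piMr// -expR0 ler_expR oppr_le0 mulr_ge0 ?sqr_ge0// ltW.
(* Half of the Gaussian pays for the new factor [x], the other half for [p]; hence the induction
   over all [a]. *)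
rewrite [in leLHS](splitr a) gaussianD normrM mulrACA ler_pM//.
- by rewrite mulr_ge0 ?gaussian_ge0.
- by rewrite mulr_ge0 ?gaussian_ge0.
- exact: norm_gaussian_le.
Qed.

Lemma derive1n_gaussian a n : exists p : {poly R},
  derive1n n (gaussian a) = (fun x => p.[x] * gaussian a x).
Proof.
elim: n => [|n [p IH]].
  by exists 1; apply/funext => x; rewrite hornerE mul1r.
(* The recursion of the Hermite polynomials, up to normalization. *)
exists (p^`() - (2 * a) *: 'X * p); apply/funext => x.
rewrite derive1nS IH derive1E.
have dg := is_derive_gaussian a x; have dp := is_derive_poly p x.
rewrite (@derive_val _ _ _ _ _ _ _ (is_deriveM dp dg)) /GRing.scale/=.
by rewrite hornerD hornerN hornerM hornerZ hornerX; ring.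
Qed.

Lemma schwartz_gaussian a : 0 < a -> schwartz (fun x => (gaussian a x, 0)).
Proof.
move=> a0; split => /=; split.
- move=> n x; have [p ->] := derive1n_gaussian a n.
  have dg := is_derive_gaussian a x; have dp := is_derive_poly p x.
  by have [] := is_deriveM dp dg.
- move=> k n; have [p ->] := derive1n_gaussian a n.
  have [M pM] := horner_gaussian_bounded ('X^k * p) a a0; exists M => x.
  apply: le_trans (pM x); rewrite !hornerE normrM (ger0_norm (gaussian_ge0 a x)).
  by rewrite normrM normrX mulrA.
- move=> n x; rewrite (_ : derive1n n _ = cst 0)//.
  by elim: n => // n IH; rewrite derive1nS IH; apply/funext => y; rewrite derive1_cst.
- move=> k n; exists 0 => x; rewrite (_ : derive1n n _ = cst 0) ?normr0 ?mulr0//.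
  by elim: n => // n IH; rewrite derive1nS IH; apply/funext => y; rewrite derive1_cst.
Qed.

End Gaussian.

(** * The Fourier transform of a Gaussian, through a differential equation in the frequency *)

Section FourierGaussian.
Context {R : realType}.
Notation mu := (@lebesgue_measure R).
Implicit Types (a th x xi y : R) (f g : R -> R).

(** The integrals over growing symmetric intervals are differences of boundary values, which vanish
    in the limit by the decay of [g]; dominated convergence identifies this limit with the integral
    over the line. *)
Lemma Rintegral_derivative_eq0 g g' M : (forall x, is_derive x 1 g (g' x)) ->
  continuous g' -> mu.-integrable setT (EFin \o g') ->
  (forall x, `|x| * `|g x| <= M) -> Rintegral mu setT g' = 0.
Proof.
move=> dg cg' ig' gM.
(* The shift to [n.+1] keeps the intervals nondegenerate and makes the boundary terms at most [2 M]
   times [harmonic n]. *)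
pose I n : set R := `[- n.+1%:R, n.+1%:R]%classic.
have cg : continuous g.
  move=> x; apply/differentiable_continuous/derivable1_diffP.
  by have [] := dg x.
have intI n : (\int[mu]_(x in I n) (g' x)%:E = (g n.+1%:R)%:E - (g (- n.+1%:R))%:E)%E.
  apply: continuous_FTC2.
  - by rewrite gtrN// ltr0n.
  - exact: continuous_subspaceT.
  - split.
    + by move=> x _; have [] := dg x.
    + exact/cvg_at_right_filter/cg.
    + exact/cvg_at_left_filter/cg.
  - by move=> x _; rewrite derive1E (@derive_val _ _ _ _ _ _ _ (dg x)).
have mg' : measurable_fun setT (EFin \o g') by case/integrableP: ig'.
have := @dominated_convergence _ _ _ mu setT measurableT
  (fun n => (EFin \o g') \_ (I n)) (EFin \o g') (fun x => `|(g' x)%:E|%E).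
case.
- move=> n; apply/(measurable_restrictT _ _).1; first exact: measurable_itv.
  exact: (measurable_funS measurableT (@subsetT _ _) mg').
- by [].
- apply: aeW => x _; apply: cvg_near_cst; near=> n; apply/patchT.
  rewrite inE /I/= in_itv/= -ler_norml.
  apply: (@le_trans _ _ n%:R); last by rewrite ler_nat.
  by near: n; exact: nbhs_infty_ger.
- exact: integrable_abse.
- apply: aeW => x n _; rewrite /patch; case: ifPn => // _.
  by rewrite abse0 abse_ge0.
move=> _ _ h.
have : (\int[mu]_x ((EFin \o g') \_ (I n)) x)%E @[n --> \oo] --> (0:R)%:E.
  under eq_fun do rewrite -integral_mkcond intI -EFinB.
  apply: cvg_EFin; first by near=> n.
  apply: norm_cvg0; rewrite /comp/=.
  apply: (@squeeze_cvgr _ _ _ _ (cst 0) (fun n => (M + M) * harmonic n)).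
  - near=> n; rewrite normr_ge0 /harmonic/= ler_pdivlMr ?ltr0n//.
    have h1 := gM n.+1%:R; have h2 := gM (- n.+1%:R).
    rewrite normrN ger0_norm ?ler0n// in h1 h2.
    rewrite mulrC; apply: le_trans (lerD h1 h2); rewrite -mulrDr.
    by rewrite ler_wpM2l ?ler0n// ler_normB.
  - exact: cvg_cst.
  - by rewrite -[X in _ --> X](mulr0 (M + M)); apply: cvgMr; exact: cvg_harmonic.
move/(cvg_unique _ h) => h0.
by rewrite /Rintegral h0.
Unshelve. all: by end_near.
Qed.

(* The phase [th] treats both parts of the Fourier transform at once, since
   [cos (u + pi / 2) = - sin u]. *)
Definition cos_gaussian a th xi : R :=
  Rintegral mu setT (fun x => cos (x * xi + th) * gaussian a x).

Lemma continuous_sinM xi th : continuous (fun x : R => sin (x * xi + th)).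
Proof.
move=> x; apply: (@continuous_comp _ _ _ (fun x => x * xi + th) sin).
  by apply: cvgD; [apply: cvgMl; exact: cvg_id|exact: cvg_cst].
exact: continuous_sin.
Qed.

Lemma continuous_cosM xi th : continuous (fun x : R => cos (x * xi + th)).
Proof.
move=> x; apply: (@continuous_comp _ _ _ (fun x => x * xi + th) cos).
  by apply: cvgD; [apply: cvgMl; exact: cvg_id|exact: cvg_cst].
exact: continuous_cos.
Qed.

Lemma norm_le_piMl x y z : `|x| <= 1 -> `|y| <= z -> `|x * y| <= z.
Proof.
by move=> x1 yz; rewrite normrM; apply: le_trans yz; exact: ler_piMl.
Qed.

Lemma integrable_cos_gaussian a th xi : 0 < a ->
  mu.-integrable setT (EFin \o (fun x => cos (x * xi + th) * gaussian a x)).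
Proof.
move=> a0; apply: (integrable_le_gaussian a 1) => //.
  apply: continuous_measurable_fun => x; apply: cvgM.
    exact: continuous_cosM.
  exact: continuous_gaussian.
move=> x; rewrite mul1r; apply: norm_le_piMl; first exact: cos_max.
by rewrite ger0_norm ?gaussian_ge0.
Qed.

Lemma continuous_xsin_gaussian a th xi :
  continuous (fun x : R => - (x * sin (x * xi + th)) * gaussian a x).
Proof.
move=> x; apply: cvgM; last exact: continuous_gaussian.
by apply: cvgN; apply: cvgM; [exact: cvg_id|exact: continuous_sinM].
Qed.

Lemma norm_xsin_gaussian a th xi x : 0 < a ->
  `|- (x * sin (x * xi + th)) * gaussian a x|
    <= (1 + (a / 2)^-1) * gaussian (a / 2) x.
Proof.
move=> a0; apply: le_trans (norm_gaussian_le_half a x a0).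
rewrite normrM normrN normrM (ger0_norm (gaussian_ge0 a x)).
by rewrite ler_wpM2r ?gaussian_ge0// ler_piMr// sin_max.
Qed.

Lemma integrable_xsin_gaussian a th xi : 0 < a ->
  mu.-integrable setT (EFin \o (fun x => - (x * sin (x * xi + th)) * gaussian a x)).
Proof.
move=> a0.
apply: (integrable_le_gaussian (a / 2) (1 + (a / 2)^-1)); first lra.
  by apply: continuous_measurable_fun; exact: continuous_xsin_gaussian.
by move=> x; exact: norm_xsin_gaussian.
Qed.

(* The integral of [d/dx (sin (x xi) e^(-a x^2))] over the line vanishes. *)
Lemma Rintegral_xsin_gaussian a th xi : 0 < a ->
  Rintegral mu setT (fun x => - (x * sin (x * xi + th)) * gaussian a x) =
  - (xi / (2 * a)) * cos_gaussian a th xi.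
Proof.
move=> a0.
pose g' x := xi * (cos (x * xi + th) * gaussian a x) +
  (2 * a) * (- (x * sin (x * xi + th)) * gaussian a x).
have ic := integrable_cos_gaussian a th xi a0.
have isn := integrable_xsin_gaussian a th xi a0.
have iZ (f : R -> R) k : mu.-integrable setT (EFin \o f) ->
    mu.-integrable setT (EFin \o (fun x => k * f x)).
  by move=> fi; apply: (@integrableZl _ _ _ mu setT measurableT k (EFin \o f) fi).
have : Rintegral mu setT g' = 0.
  apply: (@Rintegral_derivative_eq0 (fun x => sin (x * xi + th) * gaussian a x) g' (1 + a^-1)).
  - move=> x; have dg := is_derive_gaussian a x.
    apply: is_derive_eq; rewrite /GRing.scale/= /g'.
    by ring.
  - move=> x; apply: cvgD; apply: cvgM; first exact: cvg_cst.
    + by apply: cvgM; [exact: continuous_cosM|exact: continuous_gaussian].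
    + exact: cvg_cst.
    + exact: continuous_xsin_gaussian.
  - pose f1 x := xi * (cos (x * xi + th) * gaussian a x).
    pose f2 x := (2 * a) * (- (x * sin (x * xi + th)) * gaussian a x).
    rewrite (_ : _ \o _ = ((EFin \o f1) \+ (EFin \o f2))%E)//.
    by apply: integrableD => //; exact: iZ.
  - move=> x; apply: le_trans (norm_gaussian_le a x a0).
    rewrite ler_wpM2l//; apply: norm_le_piMl; first exact: sin_max.
    by rewrite ger0_norm ?gaussian_ge0.
rewrite /g' RintegralD//; [|exact: iZ|exact: iZ].
rewrite !RintegralZl// -/(cos_gaussian a th xi) => h.
have a20 : 2 * a != 0 by rewrite mulf_neq0// gt_eqF.
apply: (mulfI a20); move: h => /eqP; rewrite addr_eq0 => /eqP h.
by rewrite -[LHS]opprK -h; field; rewrite gt_eqF.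
Qed.

(** Differentiation under the integral produces the factor [- x sin], which
    [Rintegral_xsin_gaussian] turns back into [cos_gaussian]: a first-order linear equation in
    [xi]. *)
Lemma is_derive_cos_gaussian a th xi : 0 < a ->
  is_derive xi 1 (cos_gaussian a th) (- (xi / (2 * a)) * cos_gaussian a th xi).
Proof.
move=> a0; rewrite -Rintegral_xsin_gaussian//.
pose f y x := cos (x * y + th) * gaussian a x.
have df y x : is_derive y 1 (f ^~ x) (- (x * sin (x * y + th)) * gaussian a x).
  by apply: is_derive_eq; rewrite /GRing.scale/=; ring.
have pf y x : partial1of2 f y x = - (x * sin (x * y + th)) * gaussian a x.
  by rewrite partial1of2E (@derive_val _ _ _ _ _ _ _ (df y x)).
(* The dominating function does not depend on the frequency, so any open interval around [xi] would
   do. *)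
have Ixi : `]xi - 1, xi + 1[%classic xi.
  by rewrite /= in_itv/=; apply/andP; split; lra.
have intf y : `]xi - 1, xi + 1[%classic y ->
    mu.-integrable setT (EFin \o f y) by move=> _; exact: integrable_cos_gaussian.
have derf y x : `]xi - 1, xi + 1[%classic y -> setT x -> derivable (f ^~ x) y 1.
  by move=> _ _; have [] := df y x.
have G0 x : 0 <= (1 + (a / 2)^-1) * gaussian (a / 2) x.
  by rewrite mulr_ge0 ?gaussian_ge0// addr_ge0// invr_ge0; lra.
have iG : mu.-integrable setT
    (EFin \o (fun x => (1 + (a / 2)^-1) * gaussian (a / 2) x)).
  apply: (integrable_le_gaussian (a / 2) (1 + (a / 2)^-1)); first lra.
    apply: continuous_measurable_fun => x; apply: cvgM; first exact: cvg_cst.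
    exact: continuous_gaussian.
  by move=> x; rewrite ger0_norm.
have Gub y x : `]xi - 1, xi + 1[%classic y -> setT x ->
    `|partial1of2 f y x| <= (1 + (a / 2)^-1) * gaussian (a / 2) x.
  by move=> _ _; rewrite pf; exact: norm_xsin_gaussian.
apply: DeriveDef.
  exact: (derivable_under_integral measurableT Ixi intf derf G0 iG Gub).
rewrite -derive1E (differentiation_under_integral measurableT Ixi intf derf G0 iG Gub).
by apply: eq_Rintegral => x _; rewrite pf.
Qed.

(** The reciprocal of the expected Gaussian is an integrating factor: the product has zero
    derivative, so it equals its value at frequency [0], a plain Gaussian integral. *)
Lemma cos_gaussianE a th xi : 0 < a ->
  cos_gaussian a th xi = cos th * Num.sqrt (pi / a) * gaussian ((4 * a)^-1) xi.
Proof.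
move=> a0.
have h : cos_gaussian a th xi * gaussian (- (4 * a)^-1) xi =
    cos_gaussian a th 0 * gaussian (- (4 * a)^-1) 0.
  apply: (@is_derive_0_is_cst _ (fun y => cos_gaussian a th y * gaussian (- (4 * a)^-1) y)).
  move=> y; have d1 := is_derive_cos_gaussian a th y a0.
  have d2 := is_derive_gaussian (- (4 * a)^-1) y.
  apply: is_derive_eq; rewrite /GRing.scale/=.
  by field; rewrite gt_eqF.
have c0 : cos_gaussian a th 0 = cos th * Num.sqrt (pi / a).
  rewrite -Rintegral_gaussian// -RintegralZl//; last exact: integrable_gaussian.
  by apply: eq_Rintegral => x _; rewrite mulr0 add0r.
rewrite c0 in h.
have g0 b : gaussian b 0 = 1 :> R by rewrite /gaussian expr0n/= mulr0 oppr0 expR0.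
rewrite g0 mulr1 in h; rewrite -h -mulrA -gaussianD addNr.
by rewrite /gaussian mul0r oppr0 expR0 mulr1.
Qed.

(** The real part is the phase [th = 0]; the imaginary part is [th = pi / 2], where the factor
    [cos th] vanishes. *)
Lemma fourier_gaussian a xi : 0 < a ->
  fourier (fun x => (gaussian a x, 0)) xi =
  (Num.sqrt (pi / a) * gaussian ((4 * a)^-1) xi, 0).
Proof.
move=> a0; rewrite /fourier; congr pair.
  under eq_Rintegral do rewrite /= mulr0 addr0.
  have := cos_gaussianE a 0 xi a0; rewrite cos0 mul1r => <-.
  by apply: eq_Rintegral => x _; rewrite addr0.
have := cos_gaussianE a (pi / 2) xi a0; rewrite cos_pihalf !mul0r => h.
by rewrite -[RHS]h; apply: eq_Rintegral => x _; rewrite cosDpihalf/= mulr0 sub0r mulNr.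
Qed.

End FourierGaussian.

(** * Lower bound for the propagator on Gaussian data *)

Section PropagatorLowerBound.
Context {R : realType}.
Notation mu := (@lebesgue_measure R).
Implicit Types (b t x xi y : R).

Lemma norm_sin_le x : `|sin x| <= `|x|.
Proof.
wlog x0 : x / 0 <= x => [h|].
  have [|/ltW x0] := leP 0 x; first exact: h.
  by rewrite -normrN -sinN -[leRHS]normrN h// oppr_ge0.
have [|c _] := @MVT_segment R sin cos 0 x x0 (fun x _ => is_derive_sin x).
  exact/continuous_subspaceT/continuous_sin.
by rewrite sin0 !subr0 => ->; rewrite normrM ler_piMl// cos_max.
Qed.

(** The half-angle formula reduces this to [|sin (x / 2)| <= |x / 2|]. *)
Lemma cos_ge_quadratic x : 1 - x ^+ 2 / 2 <= cos x.
Proof.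
have -> : cos x = 1 - 2 * sin (x / 2) ^+ 2.
  rewrite -[in LHS](_ : (x / 2) *+ 2 = x); last by rewrite -mulr_natr divfK.
  by rewrite cos_mulr2n cos2sin2 -mulr_natr; ring.
have : sin (x / 2) ^+ 2 <= (x / 2) ^+ 2.
  rewrite -(real_normK (num_real (sin _))) -(real_normK (num_real (x / 2))).
  by rewrite lerXn2r ?nnegrE// norm_sin_le.
by move: (sin _ ^+ 2) => z; rewrite exprMn; lra.
Qed.

(** As [exp (- z) <= 1] and [1 - cos x >= 0], replacing the cosine by [1] costs at most [x^2 / 2],
    whatever its sign. *)
Lemma expR_cos_ge z x : 0 <= z -> 1 - z - x ^+ 2 / 2 <= expR (- z) * cos x.
Proof.
move=> z0; have h1 := expR_ge1Dx (- z); have h2 := cos_ge_quadratic x.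
have h3 : expR (- z) <= 1 by rewrite -expR0 ler_expR oppr_le0.
by have h4 := cos_le1 x; have h5 := expR_ge0 (- z); nra.
Qed.

Lemma sqr_gaussian_le a x : 0 < a -> x ^+ 2 * gaussian a x <= a^-1.
Proof.
move=> a0; rewrite /gaussian expRN ler_pdivrMr ?expR_gt0// ler_pdivlMl//.
by apply: le_trans (expR_ge1Dx _); rewrite lerDr.
Qed.

Lemma continuous_multiplier b c y t : continuous (fun xi : R =>
  expR (- (c * xi ^+ 2)) * (cos (y * xi + t * xi ^+ 2) * gaussian b xi)).
Proof.
move=> x; have d2 := is_derive_gaussian b x.
apply/differentiable_continuous/derivable1_diffP.
exact: ex_derive.
Qed.

(* With [g = gaussian (2 b)^-1], the errors [xi^2 g] and [xi^4 g] are absorbed in the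
   wider Gaussian of parameter [(4 b)^-1] at the price of factors [4 b] and [64 b^2]. *)
Lemma multiplier_lower_bound b c y t xi : 0 < b -> 0 <= c ->
  y ^+ 2 * b <= 64^-1 -> c * b <= 64^-1 -> (t * b) ^+ 2 <= 4096^-1 ->
  gaussian ((2 * b)^-1) xi - 9 / 64 * gaussian ((4 * b)^-1) xi <=
  expR (- (c * xi ^+ 2)) * (cos (y * xi + t * xi ^+ 2) * gaussian ((2 * b)^-1) xi).
Proof.
move=> b0 c0 yb cb tb; rewrite mulrA.
set g := gaussian _ xi; set h := gaussian _ xi.
have g0 : 0 < g by exact: gaussian_gt0.
have h0 : 0 < h by exact: gaussian_gt0.
set w := expR _ * _.
have z0 : 0 <= c * xi ^+ 2 by rewrite mulr_ge0 ?sqr_ge0.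
(* The phase is split by [(u + v)^2 / 2 <= u^2 + v^2]. *)
have wlb : 1 - (c + y ^+ 2) * xi ^+ 2 - t ^+ 2 * xi ^+ 4 <= w.
  apply: le_trans (expR_cos_ge _ _ z0).
  have : 0 <= (y * xi - t * xi ^+ 2) ^+ 2 by exact: sqr_ge0.
  by nra.
have gE : g = h * h.
  rewrite /g /h -gaussianD (_ : (2 * b)^-1 = (4 * b)^-1 + (4 * b)^-1)//.
  by field; rewrite gt_eqF.
pose k := gaussian ((8 * b)^-1) xi.
have hE : h = k * k.
  rewrite /k /h -gaussianD (_ : (4 * b)^-1 = (8 * b)^-1 + (8 * b)^-1)//.
  by field; rewrite gt_eqF.
have e2 : xi ^+ 2 * h <= 4 * b.
  by rewrite -[leRHS]invrK; apply: sqr_gaussian_le; rewrite invr_gt0; lra.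
have ek : xi ^+ 2 * k <= 8 * b.
  by rewrite -[leRHS]invrK; apply: sqr_gaussian_le; rewrite invr_gt0; lra.
have k0 : 0 <= k by exact: gaussian_ge0.
have e4 : xi ^+ 4 * h <= 64 * b ^+ 2.
  have -> : xi ^+ 4 * h = (xi ^+ 2 * k) ^+ 2 by rewrite hE; ring.
  have -> : 64 * b ^+ 2 = (8 * b) ^+ 2 by ring.
  by rewrite lerXn2r ?nnegrE//; [rewrite mulr_ge0 ?sqr_ge0//|lra].
have cy0 : 0 <= c + y ^+ 2 by rewrite addr_ge0 ?sqr_ge0.
(* The constant [9 / 64] is the sum of [4 (c + y^2) b <= 8 / 64] and [64 (t b)^2 <= 1 / 64]. *)
have E2 : (c + y ^+ 2) * (xi ^+ 2 * h) <= 8 / 64.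
  apply: (@le_trans _ _ ((c + y ^+ 2) * (4 * b))); first by rewrite ler_wpM2l.
  by lra.
have E4 : t ^+ 2 * (xi ^+ 4 * h) <= 64^-1.
  apply: (@le_trans _ _ (t ^+ 2 * (64 * b ^+ 2))); first by rewrite ler_wpM2l ?sqr_ge0.
  by move: tb; rewrite exprMn; lra.
apply: (@le_trans _ _ ((1 - (c + y ^+ 2) * xi ^+ 2 - t ^+ 2 * xi ^+ 4) * g)); last first.
  by rewrite ler_wpM2r// ltW.
rewrite gE.
have : h * ((c + y ^+ 2) * (xi ^+ 2 * h) + t ^+ 2 * (xi ^+ 4 * h)) <= h * (9 / 64).
  by rewrite ler_wpM2l ?(ltW h0)//; lra.
by move: ((c + y ^+ 2)) => d; lra.
Qed.

Lemma cnorm_Pgamma_gaussian_ge gamma b y t : 0 < b ->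
  y ^+ 2 * b <= 64^-1 -> powR t gamma * b <= 64^-1 -> (t * b) ^+ 2 <= 4096^-1 ->
  2^-1 <= cnorm (Pgamma gamma (fun x => (gaussian (b / 2) x, 0)) y t).
Proof.
move=> b0 yb tgb tb; rewrite /Pgamma; set c := powR t gamma in tgb *.
have c0 : 0 <= c by exact: powR_ge0.
have b20 : 0 < b / 2 by lra.
have p0 : 0 < pi :> R := pi_gt0 R.
set P1 := (2 * pi)^-1 * _; set P2 := (2 * pi)^-1 * _.
(* The real part alone is large enough. *)
suff P1_ge : 2^-1 <= P1.
  apply: (le_trans P1_ge); apply: (le_trans (ler_norm _)).
  by rewrite /cnorm/= -sqrtr_sqr ler_wsqrtr// lerDl sqr_ge0.
pose g xi := gaussian ((2 * b)^-1) xi.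
pose h xi := gaussian ((4 * b)^-1) xi.
pose m xi := expR (- (c * xi ^+ 2)) * (cos (y * xi + t * xi ^+ 2) * g xi).
have i20 : 0 < (2 * b)^-1 by rewrite invr_gt0; lra.
have i40 : 0 < (4 * b)^-1 by rewrite invr_gt0; lra.
have im : mu.-integrable setT (EFin \o m).
  apply: (integrable_le_gaussian (2 * b)^-1 1) => //.
    by apply: continuous_measurable_fun; exact: continuous_multiplier.
  move=> x; rewrite mul1r /m.
  apply: norm_le_piMl.
    by rewrite ger0_norm ?expR_ge0// -expR0 ler_expR oppr_le0 mulr_ge0 ?sqr_ge0.
  apply: norm_le_piMl; first exact: cos_max.
  by rewrite ger0_norm ?gaussian_ge0.
have -> : P1 = (2 * pi)^-1 * (Num.sqrt (pi / (b / 2)) * Rintegral mu setT m).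
  rewrite /P1; congr *%R; rewrite -RintegralZl//; apply: eq_Rintegral => x _.
  rewrite fourier_gaussian//= mulr0 subr0 /m /g.
  rewrite (_ : 4 * (b / 2) = 2 * b); last by field.
  by ring.
have ig := integrable_gaussian _ i20; have ih := integrable_gaussian _ i40.
have ih' : mu.-integrable setT (EFin \o (fun x => 9 / 64 * h x)).
  by apply: (@integrableZl _ _ _ mu setT measurableT (9 / 64) (EFin \o h) ih).
have lb : Num.sqrt (pi / (2 * b)^-1) - 9 / 64 * Num.sqrt (pi / (4 * b)^-1)
    <= Rintegral mu setT m.
  rewrite -!Rintegral_gaussian// -RintegralZl// -RintegralB//.
  apply: le_Rintegral => //.
    by apply: (@integrableB _ _ _ mu setT measurableT (EFin \o g) _ ig ih').
  by move=> x _; exact: multiplier_lower_bound.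
rewrite [leLHS](_ : _ = (2 * pi)^-1 * pi); last first.
  (* [pi] is generalized because [field] would unfold it. *)
  by move: (pi) p0 => p p0; field; rewrite gt_eqF.
apply: ler_wpM2l; first by rewrite invr_ge0; lra.
apply: (@le_trans _ _ (Num.sqrt (pi / (b / 2)) *
    (Num.sqrt (pi / (2 * b)^-1) - 9 / 64 * Num.sqrt (pi / (4 * b)^-1)))); last first.
  by rewrite ler_wpM2l ?sqrtr_ge0.
have e1 : Num.sqrt (pi / (b / 2)) * Num.sqrt (pi / (2 * b)^-1) = 2 * pi.
  rewrite -sqrtrM; last by rewrite divr_ge0//; lra.
  rewrite [X in Num.sqrt X](_ : _ = (2 * pi) ^+ 2); last first.
    by move: (pi) p0 => p p0; field; rewrite gt_eqF.
  by rewrite sqrtr_sqr ger0_norm//; lra.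
(* The exact value is [sqrt 8 * pi]; the cruder [4 pi] still gives [2 pi - 9 / 64 * 4 pi >= pi]. *)
have e2 : Num.sqrt (pi / (b / 2)) * Num.sqrt (pi / (4 * b)^-1) <= 4 * pi.
  rewrite -sqrtrM; last by rewrite divr_ge0//; lra.
  rewrite -[leRHS]ger0_norm; last lra.
  rewrite -sqrtr_sqr ler_wsqrtr//.
  rewrite [leLHS](_ : _ = 8 * pi ^+ 2); last first.
    by move: (pi) p0 => p p0; field; rewrite gt_eqF.
  by rewrite exprMn ler_wpM2r ?sqr_ge0//; lra.
by rewrite mulrBr mulrCA e1; lra.
Qed.

End PropagatorLowerBound.

(* Unlike [ge0_le_integral], no measurability is required: the integral of a nonnegative
   function is defined as a supremum over the simple functions below it. *)
Lemma ge0_integral_homo d (T : measurableType d) (R : realType)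
    (mu : {measure set T -> \bar R}) (f g : T -> \bar R) :
  (forall x, 0 <= f x)%E -> (forall x, f x <= g x)%E ->
  (\int[mu]_x f x <= \int[mu]_x g x)%E.
Proof.
move=> f0 fg; have g0 x : (0 <= g x)%E by exact: le_trans (f0 x) (fg x).
rewrite !ge0_integralTE//; apply: le_ereal_sup => _ [h hf <-].
by exists h => // x; exact: le_trans (hf x) (fg x).
Qed.

(** * Both sides of the maximal inequality for Gaussian data *)

Section TestFunction.
Context {R : realType}.
Notation mu := (@lebesgue_measure R).
Implicit Types (b s x xi : R) (M : R -> R).

Lemma cnorm_ge0 (z : R * R) : 0 <= cnorm z.
Proof. exact: sqrtr_ge0. Qed.

(** The squared modulus of the Fourier transform is [2 pi / b] times [gaussian b^-1]. The majorant
    [M] is left free because negative and nonnegative [s] call for different ones. *)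
Lemma Hs_norm_gaussian_le b s M : 0 < b ->
  mu.-integrable setT (EFin \o M) ->
  (forall xi, powR (1 + xi ^+ 2) s * gaussian b^-1 xi <= M xi) ->
  (Hs_norm s (fun x => (gaussian (b / 2)%R x, 0%R)) <=
    (Num.sqrt (2 * pi / b * Rintegral mu setT M)%R)%:E)%E.
Proof.
move=> b0 iM bM; have p0 : 0 < pi :> R := pi_gt0 R.
pose k : R := 2 * pi / b.
have k0 : 0 < k by rewrite divr_gt0//; lra.
have M0 xi : 0 <= M xi.
  by apply: le_trans (bM xi); rewrite mulr_ge0 ?gaussian_ge0 ?powR_ge0.
have IM0 : 0 <= Rintegral mu setT M by exact: Rintegral_ge0.
rewrite /Hs_norm -powR12_sqrt; last by rewrite mulr_ge0// ltW.
rewrite -poweR_EFin; apply: gt0_ler_poweR => //.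
- by rewrite in_itv/= leey andbT integral_ge0// => x _; rewrite lee_fin sqr_ge0.
- by rewrite in_itv/= leey andbT lee_fin mulr_ge0// ltW.
have E xi : (powR (1 + xi ^+ 2) (s / 2) *
    cnorm (fourier (fun x => (gaussian (b / 2) x, 0)) xi)) ^+ 2 =
    k * (powR (1 + xi ^+ 2) s * gaussian b^-1 xi).
  have xi0 : 0 <= 1 + xi ^+ 2 by rewrite addr_ge0 ?sqr_ge0.
  rewrite fourier_gaussian; last lra.
  rewrite /cnorm/= expr0n/= addr0 sqrtr_sqr exprMn real_normK ?num_real//.
  rewrite (_ : powR _ _ ^+ 2 = powR (1 + xi ^+ 2) s); last first.
    by rewrite -powR_mulrn ?powR_ge0// -powRrM divfK.
  rewrite exprMn sqr_sqrtr; last by rewrite divr_ge0//; lra.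
  rewrite mulrCA; congr (_ * _).
    by rewrite /k; move: (pi) p0 => p _; field; rewrite gt_eqF.
  rewrite gaussian_sqr (_ : 2 * (4 * (b / 2))^-1 = b^-1)//.
  by field; rewrite gt_eqF.
under eq_integral do rewrite E.
have -> : (k * Rintegral mu setT M)%:E = (\int[mu]_xi (k * M xi)%:E)%E.
  rewrite /Rintegral; under [in RHS]eq_integral do rewrite EFinM.
  by rewrite integralZl// EFinM fineK//; exact: integrable_fin_num.
apply: ge0_integral_homo => xi.
  by rewrite lee_fin mulr_ge0 ?(ltW k0)// mulr_ge0 ?gaussian_ge0 ?powR_ge0.
by rewrite lee_fin ler_wpM2l// ltW.
Qed.

(** The square of the supremum is at least [1 / 4] on [[0, d]], which lies in [[-1, 1]]. *)
Lemma maximal_norm_ge gamma (Gam : R -> R -> R) f d :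
  0 < d <= 1 ->
  (forall x, 0 <= x <= d -> exists2 t, 0 <= t <= 1 &
     2^-1 <= cnorm (Pgamma gamma f (Gam x t) t)) ->
  ((Num.sqrt (d / 4)%R)%:E <= maximal_norm gamma Gam f)%E.
Proof.
move=> /andP[d0 d1] Hd.
pose S x := ereal_sup [set (cnorm (Pgamma gamma f (Gam x t) t))%:E
  | t in `[0, 1]%classic].
rewrite (_ : maximal_norm _ _ _ =
  poweR (\int[mu]_(x in `[-1, 1]%classic) (S x * S x)%E) 2^-1)//.
have S0 x : (0 <= S x)%E.
  apply: (@le_trans _ _ (cnorm (Pgamma gamma f (Gam x 0) 0))%:E).
    by rewrite lee_fin cnorm_ge0.
  by apply: ereal_sup_ubound; exists 0 => //=; rewrite in_itv/= lexx ler01.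
rewrite -powR12_sqrt; last by rewrite divr_ge0// ltW.
rewrite -poweR_EFin; apply: gt0_ler_poweR => //.
- by rewrite in_itv/= leey andbT lee_fin divr_ge0// ltW.
- by rewrite in_itv/= leey andbT integral_ge0// => x _; rewrite mule_ge0.
have -> : (d / 4)%:E = (\int[mu]_(x in `[0%R, d]%classic) (4^-1)%:E)%E.
  rewrite integral_cst//= lebesgue_measure_itv/= lte_fin d0 sube0.
  by rewrite -EFinM mulrC.
(* The integrand on the right contains a supremum over uncountably many times, hence the comparison
   free of measurability. *)
rewrite integral_mkcond [leRHS]integral_mkcond; apply: ge0_integral_homo => x.
  by rewrite /patch; case: ifP => // _; rewrite lee_fin invr_ge0.
rewrite /patch; case: ifPn; last first.
  by move=> _; case: ifP => // _; rewrite mule_ge0.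
rewrite inE/= in_itv/= => /andP[x0 xd].
rewrite ifT; last by rewrite inE/= in_itv/=; apply/andP; split; lra.
have [|t t01 Pt] := Hd x; first by rewrite x0 xd.
have St : ((2^-1)%:E <= S x)%E.
  apply: (@le_trans _ _ (cnorm (Pgamma gamma f (Gam x t) t))%:E).
    by rewrite lee_fin.
  by apply: ereal_sup_ubound; exists t => //=; rewrite in_itv.
have -> : (4^-1)%:E = ((2^-1)%:E * (2^-1)%:E)%E :> \bar R.
  by rewrite -EFinM; congr EFin; field.
by apply: lee_pmul; rewrite ?lee_fin ?invr_ge0.
Qed.

Lemma maximal_inequality_gaussian gamma (Gam : R -> R -> R) s C b d M :
  (forall f : R -> R * R, schwartz f ->
     (maximal_norm gamma Gam f <= C%:E * Hs_norm s f)%E) ->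
  0 < b -> 0 < d <= 1 ->
  (forall x, 0 <= x <= d -> exists2 t, 0 <= t <= 1 &
    [/\ Gam x t ^+ 2 * b <= 64^-1, powR t gamma * b <= 64^-1 &
        (t * b) ^+ 2 <= 4096^-1]) ->
  mu.-integrable setT (EFin \o M) ->
  (forall xi, powR (1 + xi ^+ 2) s * gaussian b^-1 xi <= M xi) ->
  d / 4 <= C ^+ 2 * (2 * pi / b * Rintegral mu setT M).
Proof.
move=> hC b0 d01 Hd iM bM; have p0 : 0 < pi :> R := pi_gt0 R.
have b20 : 0 < b / 2 by lra.
have /hC := schwartz_gaussian _ b20.
set f := fun x => _ => hCf.
have max_ge : ((Num.sqrt (d / 4)%R)%:E <= maximal_norm gamma Gam f)%E.
  apply: maximal_norm_ge => // x /Hd[t t01 [h1 h2 h3]]; exists t => //.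
  exact: cnorm_Pgamma_gaussian_ge.
have Hs_le := Hs_norm_gaussian_le _ s _ b0 iM bM; rewrite -/f in Hs_le.
set J := _ / b * _ in Hs_le *.
have J0 : 0 <= J.
  rewrite mulr_ge0//; first by rewrite divr_ge0// ?(ltW b0)//; lra.
  apply: Rintegral_ge0 => xi _; apply: le_trans (bM xi).
  by rewrite mulr_ge0 ?gaussian_ge0 ?powR_ge0.
have Hs0 : (0 <= Hs_norm s f)%E by exact: poweR_ge0.
(* The sign of [C] is unknown; [|C|] is the square root of [C^2] and so merges with [sqrt J]. *)
have : ((Num.sqrt (d / 4)%R)%:E <= `|C|%:E * (Num.sqrt J)%:E)%E.
  apply: (le_trans max_ge); apply: (le_trans hCf).
  apply: (@le_trans _ _ (`|C|%:E * Hs_norm s f)%E).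
    by apply: lee_wpmul2r => //; rewrite lee_fin ler_norm.
  by apply: lee_wpmul2l.
rewrite -EFinM lee_fin -sqrtr_sqr -sqrtrM ?sqr_ge0// ler_sqrt//.
by rewrite mulr_ge0// sqr_ge0.
Qed.

End TestFunction.

(** * Sobolev weights and the two necessary conditions on [s] *)

Section Exponents.
Context {R : realType}.
Notation mu := (@lebesgue_measure R).
Implicit Types (b s x xi : R).

(** Beyond [xi^2 = m] with [m^s = e] the weight is at most [e]; below, it is at most
    [1 <= exp (m - xi^2)]. High frequencies thus cost only a small multiple of the Gaussian mass. *)
Lemma sobolev_weight_neg s e : s < 0 -> 0 < e ->
  exists2 K, 0 <= K & forall xi, powR (1 + xi ^+ 2) s <= e + K * gaussian 1 xi.
Proof.
move=> s0 e0; pose m := powR e s^-1.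
have m0 : 0 < m by exact: powR_gt0.
exists (expR m) => [|xi]; first exact: expR_ge0.
have x1 : 1 <= 1 + xi ^+ 2 by rewrite lerDl sqr_ge0.
have [xm|xm] := leP m (xi ^+ 2).
  apply: (@le_trans _ _ e); last by rewrite lerDl mulr_ge0 ?expR_ge0 ?gaussian_ge0.
  have -> : e = powR m s by rewrite -powRrM mulVf ?lt_eqF// powRr1// ltW.
  rewrite -[s]opprK powRN [leRHS]powRN lef_pV2 ?posrE ?powR_gt0//; last lra.
  by apply: ge0_ler_powR; rewrite ?nnegrE; lra.
apply: (@le_trans _ _ 1).
  by rewrite -[leRHS](powRr0 (1 + xi ^+ 2)); apply: ler_powR => //; exact: ltW.
apply: (@le_trans _ _ (expR m * gaussian 1 xi)); last by rewrite lerDr ltW.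
by rewrite /gaussian mul1r -expRD -[leLHS]expR0 ler_expR subr_ge0 ltW.
Qed.

(* [1 + u <= r exp (u / r)] with [r = 2 s + 1], so that raising to the power [s]
   leaves an exponential growth of rate less than [1 / 2]. *)
Lemma sobolev_weight_pos s b xi : 0 <= s -> 1 <= b ->
  powR (1 + xi ^+ 2) s * gaussian b^-1 xi <=
  powR (2 * s + 1) s * powR b s * gaussian (2 * b)^-1 xi.
Proof.
move=> s0 b1; pose r := 2 * s + 1; have r1 : 1 <= r by rewrite /r; lra.
have b0 : 0 < b by lra.
have r0 : 0 < r by lra.
pose u := b^-1 * xi ^+ 2.
have u0 : 0 <= u by rewrite mulr_ge0 ?sqr_ge0// invr_ge0 ltW.
have xE : xi ^+ 2 = b * u by rewrite /u mulrA divff ?mul1r// gt_eqF.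
have h : powR (1 + xi ^+ 2) s <= powR (r * b * expR (u / r)) s.
  apply: ge0_ler_powR; rewrite ?nnegrE ?addr_ge0 ?sqr_ge0//.
    by rewrite !mulr_ge0 ?expR_ge0//; lra.
  apply: (@le_trans _ _ (r * b * (1 + u / r))).
    rewrite (_ : r * b * (1 + u / r) = r * b + b * u); last by field; rewrite gt_eqF.
    by rewrite xE lerD2r; nra.
  by rewrite ler_wpM2l ?expR_ge1Dx// mulr_ge0; lra.
apply: (@le_trans _ _ (powR (r * b * expR (u / r)) s * gaussian b^-1 xi)).
  by rewrite ler_wpM2r ?gaussian_ge0.
rewrite !powRM ?expR_ge0 ?mulr_ge0//; [|lra|lra|lra|lra].
rewrite -[leLHS]mulrA ler_wpM2l ?mulr_ge0 ?powR_ge0//.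
rewrite -expRM /gaussian -expRD ler_expR -/u.
rewrite (_ : (2 * b)^-1 * xi ^+ 2 = u / 2); last by rewrite /u; field; rewrite gt_eqF.
have : u / r * s <= u / 2.
  rewrite -mulrA ler_wpM2l// ler_pdivrMl// /r; lra.
by lra.
Qed.

Lemma integrable_gaussian2 (A B a b : R) : 0 < a -> 0 < b ->
  mu.-integrable setT (EFin \o (fun x => A * gaussian a x + B * gaussian b x)).
Proof.
move=> a0 b0.
have iA := integrableZl measurableT A (integrable_gaussian _ a0).
have iB := integrableZl measurableT B (integrable_gaussian _ b0).
exact: (integrableD measurableT iA iB).
Qed.

Lemma Rintegral_gaussian2 (A B a b : R) : 0 < a -> 0 < b ->
  Rintegral mu setT (fun x => A * gaussian a x + B * gaussian b x) =
  A * Num.sqrt (pi / a) + B * Num.sqrt (pi / b).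
Proof.
move=> a0 b0.
have ia := integrable_gaussian _ a0; have ib := integrable_gaussian _ b0.
have iA := integrableZl measurableT A ia; have iB := integrableZl measurableT B ib.
by rewrite RintegralD// !RintegralZl// !Rintegral_gaussian.
Qed.

Context (alpha gamma s C : R) (alpha0 : 0 < alpha) (gamma0 : 0 < gamma).
Context (hC : forall f : R -> R * R, schwartz f ->
  (maximal_norm gamma (fun x t => (x - powR t alpha)%R) f <= C%:E * Hs_norm s f)%E).

(* Only the time [t = 0] is used. *)
Lemma sobolev_exponent_ge0 : 0 <= s.
Proof.
rewrite leNgt; apply/negP => s0.
have p0 : 0 < pi :> R := pi_gt0 R.
(* With [b = n^2] and [d = 1 / (8 n)] the tested inequality becomes [n / 32 <= A (e n + K)]. The
   choice of [e] gives [A e <= 1 / 64], so [n <= 64 A K], which the chosen [n] exceeds by one. *)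
pose A := C ^+ 2 * (2 * pi) * Num.sqrt pi.
have A0 : 0 <= A.
  by apply: mulr_ge0; [apply: mulr_ge0; [exact: sqr_ge0|lra]|exact: sqrtr_ge0].
pose e := (64 * (A + 1))^-1.
have e0 : 0 < e by rewrite invr_gt0; lra.
have [K K0 hK] := sobolev_weight_neg _ _ s0 e0.
pose n := 64 * A * K + 1.
have n1 : 1 <= n by rewrite lerDr mulr_ge0// mulr_ge0.
have n0 : 0 < n by lra.
have n20 : 0 < n ^+ 2 by exact: exprn_gt0.
have n2i : 0 < (n ^+ 2)^-1 by rewrite invr_gt0.
have : (8 * n)^-1 / 4 <= C ^+ 2 * (2 * pi / n ^+ 2 * Rintegral mu setT
    (fun xi => e * gaussian (n ^+ 2)^-1 xi + K * gaussian 1 xi)).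
  apply: (maximal_inequality_gaussian _ _ _ _ _ _ _ hC n20).
  - rewrite invr_gt0 invf_le1; lra.
  - move=> x /andP[x0 xn]; exists 0; first by rewrite lexx ler01.
    (* [powR 0 p] vanishes only for [p] nonzero, which the positivity of [alpha] and [gamma]
       ensures. *)
    rewrite !powR0 ?gt_eqF// subr0 !mul0r expr0n/=; split; [|lra|lra].
    rewrite -exprMn (_ : 64^-1 = 8^-1 ^+ 2 :> R); last by field.
    rewrite lerXn2r ?nnegrE ?mulr_ge0 ?(ltW n0)//.
    by rewrite -ler_pdivlMr// -invfM.
  - exact: integrable_gaussian2.
  - move=> xi; apply: (@le_trans _ _ ((e + K * gaussian 1 xi) * gaussian (n ^+ 2)^-1 xi)).
      by rewrite ler_wpM2r ?gaussian_ge0.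
    rewrite mulrDl lerD2l ler_piMr ?mulr_ge0 ?gaussian_ge0//.
    by rewrite /gaussian -expR0 ler_expR oppr_le0 mulr_ge0 ?sqr_ge0// ltW.
rewrite Rintegral_gaussian2// divr1 invrK sqrtrM ?(ltW p0)// sqrtr_sqr ger0_norm ?(ltW n0)//.
rewrite (_ : C ^+ 2 * _ = A * (e * n + K) / n ^+ 2); last first.
  by rewrite /A; move: (pi) (Num.sqrt pi) => p q; field; rewrite gt_eqF.
rewrite ler_pdivlMr//.
rewrite (_ : (8 * n)^-1 / 4 * n ^+ 2 = n / 32); last by field; rewrite gt_eqF.
have Ae : A * e <= 64^-1.
  by rewrite /e invfM mulrCA ler_piMr ?invr_ge0// ler_pdivrMr; lra.
have : A * e * n <= 64^-1 * n by rewrite ler_wpM2r// ltW.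
by rewrite /n; nra.
Qed.

(* Time [t = x^(1 / alpha)] follows the curve through the origin, where the
   test function of width [exp (- v)] is concentrated. *)
Lemma sobolev_exponent_ge_curve g : 0 < g -> g <= 1 -> g <= gamma -> 0 <= s ->
  2^-1 - alpha / g <= s.
Proof.
move=> g0 g1 gg s0; rewrite leNgt; apply/negP => sl.
have p0 : 0 < pi :> R := pi_gt0 R.
pose beta := alpha / g; pose l : R := ln 64.
have lE : expR l = 64 by rewrite lnK// posrE.
have l0 : 0 <= l by rewrite ln_ge0//; lra.
have beta0 : 0 < beta by exact: divr_gt0.
(* Twice the assumed gap in the exponent. With [b = exp (2 v)] the tested inequality becomes
   [exp (v e) <= K]; taking [v = K / e] contradicts [1 + K <= exp K]. *)
pose e := 1 - 2 * beta - 2 * s.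
have e0 : 0 < e by rewrite -/beta in sl; rewrite /e; lra.
pose K := 4 * (C ^+ 2 * (2 * pi * (powR (2 * s + 1) s * Num.sqrt (2 * pi)))) * expR (beta * l).
have K0 : 0 <= K.
  have h1 : 0 <= powR (2 * s + 1) s * Num.sqrt (2 * pi).
    by apply: mulr_ge0; [exact: powR_ge0|exact: sqrtr_ge0].
  apply: mulr_ge0; last exact: expR_ge0.
  apply: mulr_ge0 => //; apply: mulr_ge0; first exact: sqr_ge0.
  by apply: mulr_ge0 => //; lra.
pose v := K / e.
have v0 : 0 <= v by rewrite divr_ge0// ltW.
pose b := expR (2 * v).
have b0 : 0 < b := expR_gt0 _.
have b1 : 1 <= b by rewrite -[leLHS]expR0 ler_expR; lra.
(* The time with [t0^g * b = 1 / 64]; [d = t0^alpha] is the point whose curve reaches the origin at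
   [t0]. *)
pose t0 := expR (- ((l + 2 * v) / g)).
pose d := expR (- (beta * (l + 2 * v))).
have lv0 : 0 <= l + 2 * v by lra.
have t0g : powR t0 g * b = 64^-1.
  rewrite /t0 -expRM mulNr divfK ?gt_eqF// /b -expRD -lE -expRN.
  by congr expR; ring.
have t0E : powR d alpha^-1 = t0.
  rewrite /d -expRM; congr expR; rewrite /beta; field.
  by rewrite !gt_eqF.
have t01 : t0 <= 1 by rewrite -[leRHS]expR0 ler_expR oppr_le0 divr_ge0// ltW.
have b2i : 0 < (2 * b)^-1 by rewrite invr_gt0; lra.
(* The zero term puts the majorant in the two-Gaussian form of [Rintegral_gaussian2]. *)
have : d / 4 <= C ^+ 2 * (2 * pi / b * Rintegral mu setT
    (fun xi => powR (2 * s + 1) s * powR b s * gaussian (2 * b)^-1 xi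
               + 0 * gaussian 1 xi)).
  apply: (maximal_inequality_gaussian _ _ _ _ _ _ _ hC b0).
  - by rewrite expR_gt0/= -[leRHS]expR0 ler_expR oppr_le0 mulr_ge0// ltW.
  - move=> x /andP[x0 xd]; pose t := powR x alpha^-1.
    have tg0 : 0 <= t by exact: powR_ge0.
    have tt0 : t <= t0.
      by rewrite -t0E; apply: ge0_ler_powR; rewrite ?nnegrE ?expR_ge0// invr_ge0 ltW.
    have t1 : t <= 1 by exact: le_trans t01.
    have tgb : powR t g * b <= 64^-1.
      rewrite -t0g ler_wpM2r ?(ltW b0)//.
      by apply: ge0_ler_powR; rewrite ?nnegrE ?expR_ge0// ltW.
    (* Used with [p = gamma] for the damping and [p = 1] for the dispersion, so that the bound on
       [t^g * b] controls both. *)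
    have tp p : 0 < p -> g <= p -> powR t p <= powR t g.
      move=> pp gp; have [->|tn0] := eqVneq t 0; first by rewrite !powR0 ?gt_eqF.
      by apply: ger_powR => //; rewrite lt_neqAle eq_sym tn0 tg0.
    exists t; first by rewrite tg0.
    split.
    + rewrite /t -powRrM mulVf ?gt_eqF// powRr1// subrr expr0n/= mul0r; lra.
    + by apply: le_trans tgb; rewrite ler_wpM2r ?(ltW b0)//; exact: tp.
    + have tb : t * b <= 64^-1.
        apply: le_trans tgb; rewrite ler_wpM2r ?(ltW b0)//.
        by rewrite -[leLHS]powRr1//; exact: tp.
      rewrite (_ : 4096^-1 = 64^-1 ^+ 2 :> R); last by field.
      by rewrite lerXn2r ?nnegrE ?mulr_ge0 ?(ltW b0).
  - exact: integrable_gaussian2.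
  - by move=> xi; rewrite mul0r addr0; exact: sobolev_weight_pos.
rewrite Rintegral_gaussian2// mul0r addr0 invrK.
have -> : Num.sqrt (pi * (2 * b)) = Num.sqrt (2 * pi) * expR v.
  rewrite (_ : pi * (2 * b) = (2 * pi) * expR v ^+ 2); last first.
    by rewrite -expRM_natl -/b; ring.
  by rewrite sqrtrM ?mulr_ge0 ?(ltW p0)// sqrtr_sqr ger0_norm ?expR_ge0.
have -> : powR b s = expR (2 * v * s) by rewrite expRM.
move=> main.
have : expR (v * e) <= K.
  have -> : expR (v * e) = d * (expR (beta * l) * expR (v - 2 * v * s)).
    by rewrite /d -!expRD; congr expR; rewrite /e; ring.
  have main4 : d <= 4 * (C ^+ 2 * (2 * pi / b * (powR (2 * s + 1) s *
      expR (2 * v * s) * (Num.sqrt (2 * pi) * expR v)))) by lra.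
  have X0 : 0 <= expR (beta * l) * expR (v - 2 * v * s).
    by rewrite mulr_ge0 ?expR_ge0.
  apply: le_trans (ler_wpM2r X0 main4) _.
  rewrite le_eqVlt; apply/orP; left; apply/eqP.
  rewrite /K /b expRB (_ : expR (2 * v) = expR v * expR v); last first.
    by rewrite -expRD; congr expR; ring.
  have := expR_gt0 v; have := expR_gt0 (2 * v * s).
  move: (pi) (Num.sqrt _) (powR _ _) (expR v) (expR _) (expR _) => p q w x y z y0 x0.
  by field; rewrite !gt_eqF.
have -> : v * e = K by rewrite /v divfK// gt_eqF.
by have := expR_ge1Dx K; lra.
Qed.

End Exponents.

Theorem theorem3p1 (R : realType) (alpha gamma s : R)
  (halpha : 0 < alpha <= 1) (hgamma : 0 < gamma)
  (C : R)
  (hC : forall f : R -> R * R, schwartz f ->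
     (maximal_norm gamma (fun x t => (x - powR t alpha)%R) f <= C%:E * Hs_norm s f)%E) :
  (gamma < 1 -> Num.max (2^-1 - alpha / gamma) 0 <= s) /\
  (1 <= gamma -> Num.max (2^-1 - alpha) 0 <= s).
Proof.
have /andP[alpha0 _] := halpha.
have s0 := sobolev_exponent_ge0 _ _ _ _ alpha0 hgamma hC.
split=> hg; rewrite ge_max s0 andbT.
  exact: (sobolev_exponent_ge_curve _ _ _ _ alpha0 hgamma hC _ hgamma (ltW hg)).
rewrite -[alpha]divr1.
exact: (sobolev_exponent_ge_curve _ _ _ _ alpha0 hgamma hC _ ltr01 (lexx 1)).
Qed.
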